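(* Let $I=[t_0,t_1]$ be a compact interval, let $\theta_\star,\theta\in W^{1,\infty}(I;\mathcal P)$, and assume that $\theta$ satisfies $\dot\theta=\kappa_\theta(\theta_\star(t)-\theta(t))$ on $I$ with some $\kappa_\theta>0$. Put $r_\star(t):=\mathcal R_{\mathrm{LA}}(\theta_\star(t))$ and $r_{\mathrm{eff}}(t):=\mathcal R_{\mathrm{LA}}(\theta(t))$. Fix $\sigma\in\{+1,-1\}$ and suppose that: (D1) there exists a unique time $t_\star\in(t_0,t_1)$ such that $\sigma(r_\star(t)-1)<0$ for $t\in[t_0,t_\star)$ and $r_\star(t_\star)=1$; (D2) there exist constants $m_\star>0$ and $\Delta_\star>0$ such that $t_\star+\Delta_\star\le t_1$ and $\sigma(r_\star(t)-1)\ge m_\star(t-t_\star)$ for all $t\in[t_\star,t_\star+\Delta_\star]$; (D3) $\sigma(r_{\mathrm{eff}}(t)-1)\le\sigma(r_\star(t)-1)$ for all $t\in I$; (D4) there exists $V_\star<\infty$ such that $\|\dot\theta_\star(t)\|\le V_\star$ for a.e. $t\in I$. Let $E_\star:=\|\theta(t_0)-\theta_\star(t_0)\|+V_\star/\kappa_\theta$ and assume $L_{\mathcal R}E_\star/m_\star\le\Delta_\star$. Let $t_{\mathrm{eff}}^\sigma:=\inf\{t\in I:\sigma(r_{\mathrm{eff}}(t)-1)\ge0\}$. If in addition $\theta(t_0)=\theta_\star(t_0)$, then $$0\le t_{\mathrm{eff}}^\sigma-t_\star\le\frac{L_{\mathcal R}}{m_\star}\,\frac{V_\star}{\kappa_\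theta}.$$
   Context: Parameters are $\theta=(\alpha_L,\alpha_R,\gamma_{LR},\gamma_{RL},\mu_L,\mu_R,\delta_L,\delta_R,\eta,\rho)\in\mathcal P$, where $\mathcal P\subset\mathbb R^{10}$ is a compact convex set all of whose points have strictly positive entries. For $\theta\in\mathcal P$, $$K(\theta)=\begin{pmatrix}\alpha_L&\gamma_{RL}\\ \gamma_{LR}&\alpha_R\end{pmatrix},\quad M(\theta)=\begin{pmatrix}\mu_L&0\\0&\mu_R\end{pmatrix},\quad D(\theta)=\begin{pmatrix}\delta_L&0\\0&\delta_R\end{pmatrix},$$ $A^\dagger(\theta)=\frac{\eta}{\eta+\rho}$, $C^\dagger(\theta)=\frac{\rho}{\eta+\rho}$, and $$\mathcal R_{\mathrm{LA}}(\theta)=\lambda_{\mathrm{PF}}\bigl(M(\theta)^{-1}[C^\dagger(\theta)K(\theta)+A^\dagger(\theta)D(\theta)]\bigr),$$ where $\lambda_{\mathrm{PF}}$ is the Perron--Frobenius eigenvalue (spectral radius) of a matrix with strictly positive entries. $L_{\mathcal R}>0$ is a finite constant with $|\mathcal R_{\mathrm{LA}}(\theta_1)-\mathcal R_{\mathrm{LA}}(\theta_2)|\le L_{\mathcal R}\|\theta_1-\theta_2\|$ for all $\theta_1,\theta_2\in\mathcal P$ (such a constant exists). Norms are Euclidean. *)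

(* Defs.v *)
From HB Require Import structures.
From mathcomp Require Import all_boot all_order all_algebra.
From mathcomp Require Import complex.
From mathcomp Require Import all_classical all_reals all_analysis.

Set Implicit Arguments.
Unset Strict Implicit.
Unset Printing Implicit Defensive.

Import Order.TTheory GRing.Theory Num.Theory.
Import numFieldNormedType.Exports.

Local Open Scope classical_set_scope.
Local Open Scope ring_scope.

(* [`|v|] on ['rV[R]_n] is the sup norm in the library, hence this definition. *)
Definition enorm (R : rcfType) (n : nat) (v : 'rV[R]_n) : R :=
  Num.sqrt (\sum_(i < n) v 0 i ^+ 2).

Section parameters.
Context {R : realType}.
Implicit Types theta : 'rV[R]_10.

(* theta = (alpha_L, alpha_R, gamma_LR, gamma_RL, mu_L, mu_R,
            delta_L, delta_R, eta, rho) *)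
Definition alpha_L theta : R := theta 0 (inord 0).
Definition alpha_R theta : R := theta 0 (inord 1).
Definition gamma_LR theta : R := theta 0 (inord 2).
Definition gamma_RL theta : R := theta 0 (inord 3).
Definition mu_L theta : R := theta 0 (inord 4).
Definition mu_R theta : R := theta 0 (inord 5).
Definition delta_L theta : R := theta 0 (inord 6).
Definition delta_R theta : R := theta 0 (inord 7).
Definition eta theta : R := theta 0 (inord 8).
Definition rho theta : R := theta 0 (inord 9).

Definition mx22 (a b c d : R) : 'M[R]_2 :=
  \matrix_(i < 2, j < 2)
    if i == 0 then (if j == 0 then a else b) else (if j == 0 then c else d).

Definition Kmx theta : 'M[R]_2 :=
  mx22 (alpha_L theta) (gamma_RL theta) (gamma_LR theta) (alpha_R theta).
Definition Mmx theta : 'M[R]_2 := mx22 (mu_L theta) 0 0 (mu_R theta).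
Definition Dmx theta : 'M[R]_2 := mx22 (delta_L theta) 0 0 (delta_R theta).
Definition Adag theta : R := eta theta / (eta theta + rho theta).
Definition Cdag theta : R := rho theta / (eta theta + rho theta).

(* Spectral radius: the largest modulus of a complex eigenvalue. For a matrix
   with strictly positive entries this is the Perron-Frobenius eigenvalue. *)
Definition lambda_PF (n : nat) (A : 'M[R]_n) : R :=
  sup [set ComplexField.Normc.normc z | z in
        [set z : R[i] | eigenvalue (map_mx (real_complex R) A) z]].

Definition R_LA theta : R :=
  lambda_PF (invmx (Mmx theta) *m
    (Cdag theta *: Kmx theta + Adag theta *: Dmx theta)).

(* P is a compact convex set of parameters with strictly positive entries.
   The library topology on row vectors is the usual one of R^10. *)
Definition admissible_parameters (P : set 'rV[R]_10) : Prop :=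
  [/\ compact P, @convex_set R 'rV[R]_10 P &
      forall theta, P theta -> forall i, 0 < theta 0 i].

End parameters.

Section sobolev.
Context {R : realType}.
Implicit Types a b : R.

(* C_c^oo(]a, b[). *)
Definition test_function a b (phi : R -> R) : Prop :=
  (forall (n : nat) (x : R), derivable (derive1n n phi) x 1) /\
  closure [set x | phi x != 0] `<=` [set` `]a, b[].

Definition Linfty a b (u : R -> R) : Prop :=
  u \_ [set` `]a, b[] \in Lfun (@lebesgue_measure R) +oo%E.

Definition weak_derivative a b (u du : R -> R) : Prop :=
  forall phi : R -> R, test_function a b phi ->
    \int[@lebesgue_measure R]_(t in `]a, b[) (u t * derive1 phi t) =
    - \int[@lebesgue_measure R]_(t in `]a, b[) (du t * phi t).

(* u belongs to W^{1,oo}([a, b]; P) and du is (a version of) its derivative.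
   The Sobolev class is represented by its continuous member, so that the
   values u t, including those at the endpoints, are meaningful. *)
Definition W1infty n (P : set 'rV[R]_n) a b (u du : R -> 'rV[R]_n) : Prop :=
  [/\ {within `[a, b], continuous u},
      (forall t, t \in `[a, b] -> P (u t)) &
      forall i : 'I_n,
        [/\ Linfty a b (fun t => u t 0 i), Linfty a b (fun t => du t 0 i) &
            weak_derivative a b (fun t => u t 0 i) (fun t => du t 0 i)]].

End sobolev.

(* Main.v *)
Require Import Defs.
From HB Require Import structures.
From mathcomp Require Import all_boot all_order all_algebra.
From mathcomp Require Import all_classical all_reals all_analysis.
From mathcomp Require Import measurable_realfun ess_sup_inf ring lra.
Set Implicit Arguments.
Unset Strict Implicit.
Unset Printing Implicit Defensive.
Import Order.TTheory GRing.Theory Num.Theory.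
Import numFieldNormedType.Exports.
Local Open Scope classical_set_scope.
Local Open Scope ring_scope.

(** Let [e = theta - thetas], [r_star t = R_LA (thetas t)] and
    [r_eff t = R_LA (theta t)]. Since [e' = - kappa e - thetas'] and [e t0 = 0], the
    error satisfies [|e t| <= Vstar / kappa] on the whole interval (lemma
    [relaxation_tracking]). Hence [r_eff] differs from [r_star] by at most
    [LR * Vstar / kappa]. At time [tstar + h], where
    [h = (LR / mstar) * (Vstar / kappa) <= Deltastar], the growth condition [D2]
    makes [sigma (r_star - 1) >= mstar * h = LR * Vstar / kappa], so that
    [sigma (r_eff - 1) >= 0]: the effective crossing has occurred by then. By [D3]
    it cannot occur before [tstar].

    The derivatives are weak ones, so the error bound is obtained by testing. For a
    fixed vector [w], the scalar function [f = <w, e>] satisfies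
    [f' + kappa f <= |w| Vstar] weakly, and
    [(|w| Vstar / kappa - f(t)) exp(kappa t)] then has nonnegative weak derivative
    (lemma [weak_gronwall]). It is nondecreasing by [weak_nondecreasing], which
    rests on explicit smooth test functions, built from [exp(-1/x)], whose
    derivative is a positive bump minus another one. *)

(** * Smooth functions on the line *)

Section smooth.
Context {R : realType}.
Implicit Types f g : R -> R.

(** [diffn n f]: [f] is [n + 1] times differentiable on the line. The recursive
    form is chosen so that closure properties follow by induction on [n]. *)
Fixpoint diffn (n : nat) f : Prop :=
  (forall x, derivable f x 1) /\ (if n is m.+1 then diffn m (derive1 f) else True).

(** Infinite differentiability. *)
Definition smooth f := forall n, diffn n f.

Lemma diffn_derivable n f x : diffn n f -> derivable f x 1.
Proof. by case: n => [|n] []. Qed.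

Lemma diffnW n f : diffn n.+1 f -> diffn n f.
Proof.
elim: n f => [|n IH] f [df ddf]; first by [].
by split => //; exact: IH.
Qed.

Lemma smooth_derivable f n x : smooth f -> derivable (derive1n n f) x 1.
Proof.
move=> /(_ n); elim: n f => [|n IH] f; first by case.
by case=> _ /IH; rewrite -derive1Sn.
Qed.

Lemma derivable_smooth f :
  (forall n x, derivable (derive1n n f) x 1) -> smooth f.
Proof.
move=> df n; elim: n f df => [|n IH] f df; apply: (conj (df 0%N)); first exact: I.
apply: IH => n' x; rewrite -derive1Sn; exact: (df n'.+1 x).
Qed.

Lemma smooth_derive1 f : smooth f -> smooth (derive1 f).
Proof. by move=> sf n; have [] := sf n.+1. Qed.

(** A derivative known in closed form can stand for [derive1 f]. *)
Lemma diffn_intro n f f' : (forall x : R, is_derive x 1 f (f' x)) ->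
  (if n is m.+1 then diffn m f' else True) -> diffn n f.
Proof.
move=> df; have -> : f' = derive1 f.
  by apply/funext => x; rewrite derive1E; apply/esym/derive_val.
by case: n => [|n] //= ?; split => // x; apply: ex_derive.
Qed.

Lemma diffn_is_derive n f (x : R) : diffn n f -> is_derive x 1 f (derive1 f x).
Proof.
by move=> /(@diffn_derivable _ _ x) df; rewrite derive1E; apply: derivableP.
Qed.

Lemma diffn_cst n (c : R) : diffn n (fun=> c).
Proof.
elim: n c => [|n IH] c; apply: (@diffn_intro _ _ (fun=> 0)) => //.
Qed.

Lemma diffnD n f g : diffn n f -> diffn n g -> diffn n (fun x => f x + g x).
Proof.
elim: n f g => [|n IH] f g df dg;
  (have hd (x : R) : is_derive x 1 (fun x => f x + g x) (derive1 f x + derive1 g x)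
    by apply: is_deriveD; apply: diffn_is_derive; eassumption);
  apply: (diffn_intro hd) => //.
by apply: IH; [case: df | case: dg].
Qed.

Lemma is_derive_mul f g (x df dg : R) : is_derive x 1 f df -> is_derive x 1 g dg ->
  is_derive x 1 (fun x => f x * g x) (df * g x + f x * dg).
Proof.
move=> ? ?; apply: is_derive_eq.
by rewrite /GRing.scale/= addrC [g x * _]mulrC.
Qed.

Lemma diffnM n f g : diffn n f -> diffn n g -> diffn n (fun x => f x * g x).
Proof.
elim: n f g => [|n IH] f g df dg;
  (have hd (x : R) : is_derive x 1 (fun x => f x * g x)
      (derive1 f x * g x + f x * derive1 g x)
    by apply: is_derive_mul; apply: diffn_is_derive; eassumption);
  apply: (diffn_intro hd) => //.
by apply: diffnD; apply: IH; try exact: diffnW; [case: df | case: dg].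
Qed.

Lemma is_derive_inv f (x df : R) : f x != 0 -> is_derive x 1 f df ->
  is_derive x 1 (fun x => (f x)^-1) (- df * (f x)^-1 ^+ 2).
Proof.
move=> fx0 ?; apply: is_derive_eq.
by rewrite /GRing.scale/= exprVn !mulNr mulrC.
Qed.

Lemma diffnV n f : (forall x, f x != 0) -> diffn n f ->
  diffn n (fun x => (f x)^-1).
Proof.
move=> f0; elim: n => [|n IH] df;
  (have hd (x : R) : is_derive x 1 (fun x => (f x)^-1)
      (-1 * derive1 f x * ((f x)^-1 * (f x)^-1))
    by rewrite mulN1r -expr2; apply: is_derive_inv => //;
       apply: diffn_is_derive; eassumption);
  apply: (diffn_intro hd) => //.
apply: diffnM; first by apply: diffnM; [exact: diffn_cst | case: df].
by apply: diffnM; apply: IH; exact: diffnW.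
Qed.

Lemma is_derive_affine f (c d x df : R) : is_derive (c * x + d) 1 f df ->
  is_derive x 1 (fun x => f (c * x + d)) (c * df).
Proof.
move=> hf.
have h : is_derive x 1 (fun x => c * x + d) c.
  apply: is_derive_eq; rewrite /GRing.scale/=; ring.
have := @is_derive1_comp R f (fun x => c * x + d) x _ _ hf h.
by rewrite mulrC.
Qed.

Lemma diffn_affine n f (c d : R) : diffn n f -> diffn n (fun x => f (c * x + d)).
Proof.
elim: n f => [|n IH] f df;
  (have hd (x : R) : is_derive x 1 (fun x => f (c * x + d))
      (c * derive1 f (c * x + d))
    by apply: is_derive_affine; apply: diffn_is_derive; eassumption);
  apply: (diffn_intro hd) => //.
by apply: diffnM; [exact: diffn_cst | apply: IH; case: df].
Qed.

Lemma diffn_expR n : diffn n (@expR R).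
Proof.
elim: n => [|n IH]; apply: (@diffn_intro _ _ expR) => // x; exact: is_derive_expR.
Qed.

End smooth.

(** * Smooth transition functions *)

Section flat.
Context {R : realType}.

(** The function equal to [p(1/x) exp(-1/x)] for [x > 0] and to [0] for
    [x <= 0]. Letting the polynomial [p] vary makes the family stable under
    differentiation. *)
Definition flat (p : {poly R}) (x : R) : R :=
  if 0 < x then p.[x^-1] * expR (- x^-1) else 0.

(** Since [y ^ i <= i! exp y] for [y > 0], the factor [exp(-1/x)] absorbs every
    polynomial in [1/x]. *)
Lemma flat_bounded p : exists C, forall x, `|flat p x| <= C.
Proof.
pose C := \sum_(i < size p) `|p`_i| * i`!%:R.
exists C => x; rewrite /flat; case: ifPn => x0; last first.
  by rewrite normr0; apply: sumr_ge0 => i _; rewrite mulr_ge0.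
have y0 : 0 < x^-1 by rewrite invr_gt0.
move: (x^-1) y0 => y y0.
rewrite normrM (ger0_norm (expR_ge0 _)) expRN ler_pdivrMr ?expR_gt0//.
rewrite horner_coef /C mulr_suml; apply: (le_trans (ler_norm_sum _ _ _)).
apply: ler_sum => i _; rewrite normrM -mulrA ler_wpM2l//.
rewrite (ger0_norm (exprn_ge0 _ (ltW y0))).
case: (nat_of_ord i) => [|j].
  by rewrite expr0 fact0 mul1r; apply: le_trans (expR_ge1Dx y); rewrite lerDl ltW.
rewrite mulrC -ler_pdivrMr ?ltr0n ?fact_gt0//.
apply: le_trans (expR_ge1Dxn j (ltW y0)).
by rewrite lerDr.
Qed.

(** With [flat_bounded] this gives [flat p x = O(x ^ 2)] at the origin. *)
Lemma flat_mulX2 p x : flat p x = x ^+ 2 * flat ('X^2 * p) x.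
Proof.
rewrite /flat; case: ifPn => x0; last by rewrite mulr0.
by rewrite hornerM hornerXn; field; rewrite gt_eqF.
Qed.

Lemma is_derive_quadratic0 (f : R -> R) C : (forall x, `|f x| <= C * x ^+ 2) ->
  is_derive (0 : R) 1 f 0.
Proof.
move=> hf.
have f0 : f 0 = 0.
  by apply/eqP; rewrite -normr_le0; apply: le_trans (hf 0) _; rewrite expr0n mulr0.
have C0 : 0 <= C by have := hf 1; rewrite expr1n mulr1; apply: le_trans.
suff h : h^-1 *: (f (h *: 1 + 0) - f 0) @[h --> (0:R)^'] --> (0 : R).
  by split; [apply: cvgP h | apply/cvg_lim].
apply/cvgr0Pnorm_le => e e0.
near=> h.
have h0 : h != 0 by near: h; exact: nbhs_dnbhs_neq.
rewrite f0 subr0 addr0 /GRing.scale/= mulr1 normrM normfV.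
rewrite mulrC ler_pdivrMr ?normr_gt0//.
apply: le_trans (hf h) _.
rewrite -real_normK ?num_real// expr2 mulrA ler_wpM2r//.
have h1 : `|h| <= e / (C + 1).
  near: h; apply: dnbhs0_le; rewrite divr_gt0//; lra.
apply: (@le_trans _ _ (C * (e / (C + 1)))); first exact: ler_wpM2l.
rewrite mulrA ler_pdivrMr; lra.
Unshelve. all: by end_near.
Qed.

Lemma is_derive_flat p (x : R) :
  is_derive x 1 (flat p) (flat ('X^2 * (p - p^`())) x).
Proof.
have [x0|x0|->] := ltgtP x 0.
- rewrite /flat ltNge (ltW x0)/=.
  have H : \near x, (fun=> 0) x = flat p x.
    near=> y; rewrite /flat ifF//; apply/negbTE; rewrite -leNgt ltW//.
    by near: y; exact: lt_nbhsl.
  apply: near_eq_is_derive H _.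
- have H : \near x, p.[x^-1] * expR (- x^-1) = flat p x.
    near=> y; rewrite /flat ifT//.
    by near: y; exact: lt_nbhsr.
  apply: near_eq_is_derive H _.
  have dV : is_derive x 1 (fun y : R => y^-1) (- x^-1 ^+ 2).
    have := @is_derive_inv R id x 1.
    by rewrite mulN1r; apply; rewrite gt_eqF.
  have dp : is_derive x 1 (fun y : R => p.[y^-1]) ((p^`()).[x^-1] * - x^-1 ^+ 2).
    have hp : is_derive (x^-1) 1 (horner p) (p^`()).[x^-1].
      by rewrite derivE derive1E; apply/derivableP/derivable_horner.
    exact: (is_derive1_comp hp dV).
  have de : is_derive x 1 (fun y : R => expR (- y^-1)) (expR (- x^-1) * x^-1 ^+ 2).
    have dNV : is_derive x 1 (fun y : R => - y^-1) (x^-1 ^+ 2).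
      by rewrite -[x^-1 ^+ 2]opprK; exact: is_deriveN dV.
    exact: (is_derive1_comp (g := fun y : R => - y^-1)
      (is_derive_expR (- x^-1)) dNV).
  have := is_derive_mul dp de; congr is_derive.
  rewrite /flat x0 hornerM hornerXn hornerD hornerN; ring.
- have [C hC] := flat_bounded ('X^2 * p).
  rewrite {2}/flat ltxx.
  apply: (@is_derive_quadratic0 _ C) => y; rewrite flat_mulX2 normrM mulrC.
  by rewrite (ger0_norm (sqr_ge0 y)) ler_wpM2r ?sqr_ge0.
Unshelve. all: by end_near.
Qed.

Lemma diffn_flat n p : diffn n (flat p).
Proof.
elim: n p => [|n IH] p; apply: (diffn_intro (is_derive_flat p)) => //.
Qed.

Lemma flat1_ge0 x : 0 <= flat 1 x.
Proof. by rewrite /flat; case: ifP => // _; rewrite hornerE mul1r expR_ge0. Qed.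

Lemma flat1_gt0 x : 0 < x -> 0 < flat 1 x.
Proof. by rewrite /flat => ->; rewrite hornerE mul1r expR_gt0. Qed.

Lemma flat_le0 p x : x <= 0 -> flat p x = 0.
Proof. by rewrite /flat ltNge => ->. Qed.

Lemma derive1_flat1_ge0 x : 0 <= derive1 (flat 1) x.
Proof.
have dx := is_derive_flat 1 x.
rewrite derive1E (derive_val (is_derive := dx)) /flat; case: ifP => // x0.
rewrite -polyC1 derivC polyC1.
by rewrite subr0 mulr1 hornerXn mulr_ge0 ?expR_ge0// exprn_ge0// invr_ge0 ltW.
Qed.

(** Smooth transition from [0] on the negative half-line to [1] beyond [1], with
    [h = flat 1]: [h(x) / (h(x) + h(1 - x))]. *)
Definition step (x : R) : R := flat 1 x * (flat 1 x + flat 1 (-1 * x + 1))^-1.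

Lemma step_den_gt0 x : 0 < flat 1 x + flat 1 (-1 * x + 1).
Proof.
have [x0|x0] := leP x 0.
  by apply: ltr_wpDl; [exact: flat1_ge0 | apply: flat1_gt0; lra].
by apply: ltr_wpDr; [exact: flat1_ge0 | exact: flat1_gt0].
Qed.

Lemma smooth_step : smooth step.
Proof.
move=> n; apply: diffnM; first exact: diffn_flat.
apply: diffnV => [x|]; first by rewrite gt_eqF ?step_den_gt0.
by apply: diffnD; [exact: diffn_flat | apply: diffn_affine; exact: diffn_flat].
Qed.

Lemma step_le0 x : x <= 0 -> step x = 0.
Proof. by move=> x0; rewrite /step flat_le0// mul0r. Qed.

Lemma step_ge1 x : 1 <= x -> step x = 1.
Proof.
move=> x1; have := step_den_gt0 x; rewrite /step (@flat_le0 _ (-1 * x + 1)).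
  by rewrite addr0 => ?; rewrite mulfV// gt_eqF.
lra.
Qed.

Lemma step_ge0 x : 0 <= step x.
Proof. by rewrite mulr_ge0 ?flat1_ge0// invr_ge0 ltW// step_den_gt0. Qed.

Lemma step_le1 x : step x <= 1.
Proof. by rewrite ler_pdivrMr ?step_den_gt0// mul1r lerDl flat1_ge0. Qed.

Lemma derive1_step_ge0 x : 0 <= derive1 step x.
Proof.
have d0 := step_den_gt0 x.
have h1 : is_derive x 1 (flat 1) (derive1 (flat 1) x).
  by apply: (@diffn_is_derive _ 0); exact: diffn_flat.
have h2 : is_derive x 1 (fun x => flat 1 (-1 * x + 1))
    (-1 * derive1 (flat 1) (-1 * x + 1)).
  apply: is_derive_affine.
  by apply: (@diffn_is_derive _ 0); exact: diffn_flat.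
have h12 : is_derive x 1 (fun x => flat 1 x + flat 1 (-1 * x + 1))
  (derive1 (flat 1) x + -1 * derive1 (flat 1) (-1 * x + 1)) := is_deriveD h1 h2.
have h3 := is_derive_inv (x := x) (lt0r_neq0 d0) h12.
have h4 := is_derive_mul h1 h3.
rewrite derive1E (derive_val (is_derive := h4)).
set a := flat 1 x in d0 *; set b := flat 1 _ in d0 *.
have a0 : 0 <= a by exact: flat1_ge0.
have b0 : 0 <= b by exact: flat1_ge0.
have := derive1_flat1_ge0 x; set a' := derive1 _ x => a'0.
have := derive1_flat1_ge0 (-1 * x + 1); set b' := derive1 _ (-1 * x + 1) => b'0.
(* the quotient rule, after cancellation of the terms in a * a' *)
rewrite (_ : _ + _ = (a' * b + a * b') * (a + b)^-1 ^+ 2).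
  apply: mulr_ge0; last exact: sqr_ge0.
  exact: addr_ge0 (mulr_ge0 a'0 b0) (mulr_ge0 a0 b'0).
rewrite /=; field; exact: lt0r_neq0.
Qed.

Lemma derive1_step_lt0 x : x < 0 -> derive1 step x = 0.
Proof.
move=> x0; rewrite derive1E.
have <- : 'D_1 (cst (0 : R)) x = 0 by rewrite derive_cst.
apply: near_eq_derive; near=> y; rewrite step_le0//=.
by apply: ltW; near: y; exact: lt_nbhsl.
Unshelve. all: by end_near.
Qed.

Lemma derive1_step_gt1 x : 1 < x -> derive1 step x = 0.
Proof.
move=> x1; rewrite derive1E.
have <- : 'D_1 (cst (1 : R)) x = 0 by rewrite derive_cst.
apply: near_eq_derive; near=> y; rewrite step_ge1//=.
by apply: ltW; near: y; exact: lt_nbhsr.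
Unshelve. all: by end_near.
Qed.

End flat.

Section ramp.
Context {R : realType}.

(** The transition [step] rescaled so that it takes place on [[s, s']]. *)
Definition ramp (s s' x : R) : R := step ((s' - s)^-1 * x + - ((s' - s)^-1 * s)).

Context (s s' : R) (ss' : s < s').

Let pos : 0 < s' - s. Proof. by rewrite subr_gt0. Qed.
Let argE x : (s' - s)^-1 * x + - ((s' - s)^-1 * s) = (x - s) / (s' - s).
Proof. by rewrite -mulrBr mulrC. Qed.

Lemma smooth_ramp : smooth (ramp s s').
Proof. by move=> n; apply: diffn_affine; exact: smooth_step. Qed.

Lemma ramp_left x : x <= s -> ramp s s' x = 0.
Proof.
by move=> xs; rewrite /ramp argE step_le0// pmulr_lle0 ?invr_gt0// subr_le0.
Qed.

Lemma ramp_right x : s' <= x -> ramp s s' x = 1.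
Proof. by move=> xs; rewrite /ramp argE step_ge1// ler_pdivlMr// mul1r lerD2r. Qed.

Lemma ramp_ge0 x : 0 <= ramp s s' x. Proof. exact: step_ge0. Qed.

Lemma ramp_le1 x : ramp s s' x <= 1. Proof. exact: step_le1. Qed.

Lemma derive1_rampE x :
  derive1 (ramp s s') x = (s' - s)^-1 * derive1 step ((x - s) / (s' - s)).
Proof.
rewrite derive1E.
have h : is_derive x 1 (ramp s s')
    ((s' - s)^-1 * derive1 step ((s' - s)^-1 * x + - ((s' - s)^-1 * s))).
  by apply: is_derive_affine; apply: (@diffn_is_derive _ 0); exact: smooth_step.
by rewrite (derive_val (is_derive := h)) argE.
Qed.

Lemma derive1_ramp_ge0 x : 0 <= derive1 (ramp s s') x.
Proof. by rewrite derive1_rampE mulr_ge0 ?derive1_step_ge0// invr_ge0 ltW. Qed.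

Lemma derive1_ramp_eq0 x : (x < s) || (s' < x) -> derive1 (ramp s s') x = 0.
Proof.
rewrite derive1_rampE => /orP[xs|xs].
  by rewrite derive1_step_lt0 ?mulr0// pmulr_llt0 ?invr_gt0// subr_lt0.
by rewrite derive1_step_gt1 ?mulr0// ltr_pdivlMr// mul1r ltrD2r.
Qed.

End ramp.

(** * Functions with nonnegative weak derivative *)

Section integrals.
Context {R : realType}.
Notation mu := (@lebesgue_measure R).

Lemma derivable_continuous (f : R -> R) :
  (forall x, derivable f x 1) -> continuous f.
Proof.
by move=> df x; apply: differentiable_continuous; apply/derivable1_diffP.
Qed.

Lemma smooth_continuous (f : R -> R) : smooth f -> continuous f.
Proof.
move=> sf; apply: derivable_continuous => x.
exact: (diffn_derivable (sf 0%N)).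
Qed.

Lemma continuous_oo_integrable (a b : R) (f : R -> R) :
  {within `[a, b], continuous f} -> mu.-integrable `]a, b[ (EFin \o f).
Proof.
move=> cf; apply: (@integrableS _ _ _ mu `[a, b]) => //.
  exact: subset_itv_oo_cc.
by apply: continuous_compact_integrable => //; exact: segment_compact.
Qed.

Lemma Rintegral_derive1 (a b : R) (F : R -> R) : a < b ->
  (forall x, derivable F x 1) -> continuous (derive1 F) ->
  \int[mu]_(x in `]a, b[) derive1 F x = F b - F a.
Proof.
move=> ab dF cF.
have cFw : {within `[a, b], continuous (derive1 F)}.
  exact: continuous_subspaceT.
have hi := continuous_oo_integrable cFw.
rewrite Rintegral_itv_obnd_cbnd//.
rewrite Rintegral_itv_bndo_bndc; last first.
  apply: (@integrableS _ _ _ mu `[a, b]) => //.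
    by apply: subset_itvl; rewrite bnd_simp.
  by apply: continuous_compact_integrable => //; exact: segment_compact.
rewrite /Rintegral (@continuous_FTC2 _ _ F a b ab cFw)//.
have cont := derivable_continuous dF.
by split => // [|]; [apply: cvg_at_right_filter | apply: cvg_at_left_filter];
  exact: cont.
Qed.

Lemma smooth_test_function (a b s t : R) (chi : R -> R) :
  a < s -> t < b -> smooth chi ->
  (forall x, (x < s) || (t < x) -> chi x = 0) -> test_function a b chi.
Proof.
move=> as_ tb schi chi0; split.
  by move=> n x; exact: smooth_derivable.
apply: (@subset_trans _ `[s, t]%classic).
  have <- : closure `[s, t]%classic = `[s, t]%classic :> set R.
    by apply/esym/closure_id; exact: itv_closed.
  apply: closure_subset => x /= /eqP chix; rewrite in_itv/=.
  case: (leP s x) => xs; last by case: chix; rewrite chi0// xs.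
  case: (leP x t) => xt //; by case: chix; rewrite chi0// xt orbT.
by move=> x /=; rewrite !in_itv/= => /andP[sx xt];
  rewrite (lt_le_trans as_)//= (le_lt_trans xt).
Qed.

(** The point [s] may be an endpoint of [[a, b]], whereas the subinterval
    [[s1, s2]] has to stay inside []a, b[] to carry a test function. *)
Lemma continuous_gt_subinterval (a b s c d : R) (u : R -> R) : a < b ->
  {within `[a, b], continuous u} -> a <= s <= b -> c < u s -> 0 < d ->
  exists s1 s2, [/\ a < s1, s1 < s2, s2 < b, s - d < s1 /\ s2 < s + d &
    forall x, s1 <= x <= s2 -> c <= u x].
Proof.
move=> ab cu sab cus d0.
have [e e0 he] : exists2 e, 0 < e &
    forall x, a <= x <= b -> `|s - x| < e -> c <= u x.
  have sI : `[a, b]%classic s by rewrite /= in_itv.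
  move: (cu) => /subspace_continuousP /(_ s sI).
  move=> /cvgrPdist_lt /(_ (u s - c)); rewrite subr_gt0 => /(_ cus).
  rewrite near_withinE => -[e e0 he]; exists e => // x xab sx.
  have : `|u s - u x| < u s - c by apply: he => //=; rewrite in_itv.
  by move=> /ltr_normlP[_]; lra.
move: sab => /andP[as_ sb].
pose r := Num.min d e; have r0 : 0 < r by rewrite lt_min d0 e0.
have rd : r <= d by rewrite ge_min lexx.
have re : r <= e by rewrite ge_min lexx orbT.
have [sb'|sb'] := ltP s b.
- pose q := Num.min r (b - s); have q0 : 0 < q by rewrite lt_min r0 subr_gt0.
  have qr : q <= r by rewrite ge_min lexx.
  have qb : q <= b - s by rewrite ge_min lexx orbT.
  exists (s + q / 3), (s + 2 * q / 3); split; [lra|lra|lra|split; lra|].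
  move=> x xs; apply: he; first lra.
  by rewrite ltr_norml; lra.
- pose q := Num.min r (s - a); have q0 : 0 < q by rewrite lt_min r0 subr_gt0; lra.
  have qr : q <= r by rewrite ge_min lexx.
  have qb : q <= s - a by rewrite ge_min lexx orbT.
  exists (s - 2 * q / 3), (s - q / 3); split; [lra|lra|lra|split; lra|].
  move=> x xs; apply: he; first lra.
  by rewrite ltr_norml; lra.
Qed.

(** A continuous function whose distributional derivative is nonnegative is
    nondecreasing. If [u s > u t] with [s < t], the difference [chi] of a ramp
    near [s] and a ramp near [t] is a nonnegative test function; [chi'] is a
    bump of mass [1] where [u] is large minus a bump of mass [1] where [u] is
    small, so that the integral of [u * chi'] is positive. *)
Lemma weak_nondecreasing (a b : R) (u : R -> R) : a < b ->
  {within `[a, b], continuous u} ->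
  (forall chi, test_function a b chi -> (forall x, 0 <= chi x) ->
     \int[mu]_(t in `]a, b[) (u t * derive1 chi t) <= 0) ->
  forall s t, a <= s -> s <= t -> t <= b -> u s <= u t.
Proof.
move=> ab cu hu s t as_; rewrite le_eqVlt => /predU1P[->//|st] tb.
rewrite leNgt; apply/negP => uts.
(* two levels separating [u t] from [u s] *)
pose c := (u t + 2 * u s) / 3; pose d := (2 * u t + u s) / 3.
have cs : c < u s by rewrite /c; lra.
have dt : - d < - u t by rewrite /d; lra.
have dc : d < c by rewrite /c /d; lra.
have ts0 : 0 < (t - s) / 2 by lra.
have [|s1 [s2 [as1 s12 s2b [_ hs2] hs]]] := continuous_gt_subinterval ab cu _ cs ts0.
  by rewrite as_/=; lra.
have cNu : {within `[a, b], continuous (fun x => - u x)}.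
  by move=> x; apply: cvgN; exact: cu.
have [|t1 [t2 [at1 t12 t2b [ht1 _] ht]]] :=
  continuous_gt_subinterval (u := fun x => - u x) ab cNu _ dt ts0.
  by rewrite tb andbT; lra.
have st' : s2 < t1 by lra.
pose chi x := ramp s1 s2 x + -1 * ramp t1 t2 x.
have schi : smooth chi.
  move=> n; apply: diffnD; first exact: smooth_ramp.
  by apply: diffnM; [exact: diffn_cst | exact: smooth_ramp].
have chi_ge0 x : 0 <= chi x.
  rewrite /chi; have [xs2|xs2] := leP s2 x.
    by rewrite (ramp_right s12)//; have := ramp_le1 t1 t2 x; lra.
  by rewrite (@ramp_left _ t1 t2 t12 x) ?mulr0 ?addr0 ?ramp_ge0//; lra.
have dchiE x : derive1 chi x = derive1 (ramp s1 s2) x - derive1 (ramp t1 t2) x.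
  have h1 : is_derive x 1 (ramp s1 s2) (derive1 (ramp s1 s2) x).
    by apply: (@diffn_is_derive _ 0); exact: smooth_ramp.
  have h2 : is_derive x 1 (fun x => -1 * ramp t1 t2 x)
      (0 * ramp t1 t2 x + -1 * derive1 (ramp t1 t2) x).
    apply: is_derive_mul.
    by apply: (@diffn_is_derive _ 0); exact: smooth_ramp.
  have h : is_derive x 1 chi (derive1 (ramp s1 s2) x +
     (0 * ramp t1 t2 x + -1 * derive1 (ramp t1 t2) x)) := is_deriveD h1 h2.
  by rewrite derive1E (derive_val (is_derive := h)) mul0r add0r mulN1r.
have tchi : test_function a b chi.
  apply: (@smooth_test_function a b s1 t2) => // x /orP[xs|xt]; rewrite /chi.
    by rewrite !ramp_left ?mulr0 ?addr0//; lra.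
  by rewrite !ramp_right ?mulr1 ?addrN//; lra.
have := hu chi tchi chi_ge0.
apply/negP; rewrite -ltNge.
have cd (p q : R) : p < q -> {within `[a, b], continuous (derive1 (ramp p q))}.
  move=> pq; apply: continuous_subspaceT.
  by apply: smooth_continuous; apply: smooth_derive1; exact: smooth_ramp.
(* a ramp rises from 0 to 1, so its derivative has mass 1 *)
have Iramp (p q : R) : a < p -> p < q -> q < b ->
    \int[mu]_(x in `]a, b[) derive1 (ramp p q) x = 1.
  move=> ap pq qb; rewrite Rintegral_derive1//.
  - by rewrite ramp_right ?(ltW qb)// ramp_left ?(ltW ap)// subr0.
  - by move=> x; apply: (@diffn_derivable _ 0); exact: smooth_ramp.
  - by apply: smooth_continuous; apply: smooth_derive1; exact: smooth_ramp.
have i1 : mu.-integrable `]a, b[ (EFin \o derive1 (ramp s1 s2)).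
  by apply: continuous_oo_integrable; exact: cd.
have i2 : mu.-integrable `]a, b[ (EFin \o derive1 (ramp t1 t2)).
  by apply: continuous_oo_integrable; exact: cd.
have i1' : mu.-integrable `]a, b[ (EFin \o (fun x => c * derive1 (ramp s1 s2) x)).
  by apply: continuous_oo_integrable => x; apply: cvgM; [exact: cvg_cst | exact: cd].
have i2' : mu.-integrable `]a, b[ (EFin \o (fun x => d * derive1 (ramp t1 t2) x)).
  by apply: continuous_oo_integrable => x; apply: cvgM; [exact: cvg_cst | exact: cd].
apply: (@lt_le_trans _ _ (\int[mu]_(x in `]a, b[)
    (c * derive1 (ramp s1 s2) x - d * derive1 (ramp t1 t2) x))).
  rewrite (RintegralB _ i1' i2')// (RintegralZl c _ i1)// (RintegralZl d _ i2)//.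
  rewrite (Iramp s1 s2)// (Iramp t1 t2)// !mulr1 subr_gt0.
  exact: dc.
apply: le_Rintegral => //.
- apply: continuous_oo_integrable => x; apply: cvgB.
    by apply: cvgM; [exact: cvg_cst | exact: cd].
  by apply: cvgM; [exact: cvg_cst | exact: cd].
- apply: continuous_oo_integrable => x; apply: cvgM; first exact: cu.
  apply: (continuous_subspaceT (f := derive1 chi)).
  by apply: smooth_continuous; exact: smooth_derive1.
(* [u >= c] where the first ramp rises and [u <= d] where the second does *)
move=> x _; rewrite dchiE mulrBr; apply: lerB.
  have [/hs ux|xs] := boolP (s1 <= x <= s2).
    by apply: ler_wpM2r => //; exact: derive1_ramp_ge0.
  rewrite derive1_ramp_eq0 ?mulr0//.
  by move: xs; rewrite negb_and -!ltNge.
have [/ht ux|xs] := boolP (t1 <= x <= t2).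
  by apply: ler_wpM2r; [exact: derive1_ramp_ge0|rewrite -lerN2].
rewrite derive1_ramp_eq0 ?mulr0//.
by move: xs; rewrite negb_and -!ltNge.
Qed.

End integrals.

(** * Weak derivatives and a Gronwall inequality *)

Section ae.
Context {R : realType}.
Notation mu := (@lebesgue_measure R).

Lemma ae_imply (P Q : R -> Prop) : (forall t, P t -> Q t) ->
  {ae mu, forall t, P t} -> {ae mu, forall t, Q t}.
Proof. by move=> PQ; apply: negligibleS => t /= nQ /PQ. Qed.

Lemma ae_Rintegral_ge0 (D : set R) (f : R -> R) : measurable D ->
  measurable_fun D f -> {ae mu, forall t, D t -> 0 <= f t} ->
  0 <= \int[mu]_(t in D) f t.
Proof.
move=> mD mf f0.
suff -> : \int[mu]_(t in D) f t = \int[mu]_(t in D) Num.max (f t) 0.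
  by apply: Rintegral_ge0 => t _; rewrite le_max lexx orbT.
congr fine; apply: ae_eq_integral => //.
- exact/measurable_EFinP.
- by apply/measurable_EFinP; apply: measurable_maxr.
- by apply: ae_imply f0 => t f0 Dt; rewrite max_l// f0.
Qed.

Lemma ae_le_integrable (D : set R) (f g : R -> R) : measurable D ->
  measurable_fun D f -> mu.-integrable D (EFin \o g) ->
  {ae mu, forall t, D t -> `|f t| <= g t} -> mu.-integrable D (EFin \o f).
Proof.
move=> mD mf /integrableP[mg ig] fg; apply/integrableP; split.
  exact/measurable_EFinP.
apply: le_lt_trans ig; apply: ae_ge0_le_integral => //.
- by apply: measurableT_comp => //; exact/measurable_EFinP.
- exact: measurableT_comp.
- apply: ae_imply fg => t fg Dt /=; rewrite lee_fin.
  by apply: le_trans (fg Dt) _; exact: ler_norm.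
Qed.

End ae.

Section weakly_differentiable.
Context {R : realType}.
Notation mu := (@lebesgue_measure R).
Context (a b : R).
Implicit Types (u du v dv phi : R -> R).

(** [u] is continuous on [[a, b]] and has weak derivative [du] on []a, b[]. The
    second clause is the only integrability of [du] that the computations need,
    and, unlike a bound in L^oo, it is visibly preserved by linear combinations. *)
Definition weakly_diff u du : Prop :=
  [/\ {within `[a, b], continuous u},
      (forall phi, continuous phi ->
        mu.-integrable `]a, b[ (EFin \o (fun t => du t * phi t))) &
      weak_derivative a b u du].

Lemma test_function_smooth phi : test_function a b phi -> smooth phi.
Proof. by move=> [h _]; exact: derivable_smooth. Qed.

Lemma test_function_continuous phi : test_function a b phi -> continuous phi.
Proof. by move=> [h _]; apply: derivable_continuous => x; exact: (h 0%N). Qed.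

Lemma test_function_derive1_continuous phi :
  test_function a b phi -> continuous (derive1 phi).
Proof. by move=> [h _]; apply: derivable_continuous => x; exact: (h 1%N). Qed.

Lemma test_function_oo phi x : test_function a b phi ->
  ~~ (a < x < b) -> phi x = 0.
Proof.
move=> [_ h]; apply: contraNeq => phix.
have /h : closure [set x | phi x != 0] x by exact: subset_closure.
by rewrite /= in_itv.
Qed.

Lemma within_continuous_integrableM u phi : {within `[a, b], continuous u} ->
  continuous phi -> mu.-integrable `]a, b[ (EFin \o (fun t => u t * phi t)).
Proof.
move=> cu cphi; apply: continuous_oo_integrable => x.
by apply: cvgM; [exact: cu | exact: (continuous_subspaceT cphi)].
Qed.

Lemma Linfty_integrableM du phi : Linfty a b du -> continuous phi ->
  mu.-integrable `]a, b[ (EFin \o (fun t => du t * phi t)).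
Proof.
move=> Ldu cphi.
have mdu : measurable_fun `]a, b[ du.
  apply: (measurable_restrictT du (measurable_itv `]a, b[)).2.
  by have := set_mem (sub_Lfun_mfun Ldu).
have mphi : measurable_fun `]a, b[ phi.
  by apply: measurable_funS (continuous_measurable_fun cphi).
have [M hM] : exists M, {ae mu, forall t, `]a, b[%classic t -> `|du t| <= M}.
  have : (Lnorm mu +oo (EFin \o (du \_ `]a, b[)) < +oo)%E.
    by have := set_mem (sub_Lfun_finLfun Ldu).
  rewrite unlock/=; case: ifPn => [_|].
    move=> h; have := ess_sup_ge mu (abse \o (EFin \o (du \_ `]a, b[))).
    case: (ess_sup _ _) h => // [r|] _ h.
      exists r; apply: ae_imply h => t /=.
      by rewrite patchE => h Dt; rewrite mem_set// in h.
    by exists 0; apply: ae_imply h => t /=.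
  (* the definition of the L^oo norm distinguishes the null measure *)
  case/negP; apply: (@lt_le_trans _ _ (mu `]0%R, 1%R[%classic)).
    by rewrite lebesgue_measure_itv/= lte01 oppr0 adde0 lte01.
  by apply: le_measure; rewrite ?inE.
apply: (@ae_le_integrable _ _ _ (fun t => M * `|phi t|)) => //.
- exact: measurable_funM.
- apply: within_continuous_integrableM => //.
    by apply: continuous_subspaceT => x; exact: cvg_cst.
  by move=> x; apply: cvg_norm; exact: cphi.
- apply: ae_imply hM => t hM Dt; rewrite normrM ler_wpM2r//; exact: hM.
Qed.

Lemma weakly_diff0 : weakly_diff (fun=> 0) (fun=> 0).
Proof.
have h0 phi : (fun t => 0 * phi t) = (fun=> 0 : R).
  by apply/funext => t; rewrite mul0r.
split.
- by apply: continuous_subspaceT => x; exact: cvg_cst.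
- by move=> phi _; rewrite h0; exact: integrable0.
- by move=> phi _; rewrite !h0 Rintegral_cst// mul0r oppr0.
Qed.

Lemma weakly_diffD u du v dv : weakly_diff u du -> weakly_diff v dv ->
  weakly_diff (fun t => u t + v t) (fun t => du t + dv t).
Proof.
move=> [cu iu wu] [cv iv wv]; split.
- by move=> x; apply: cvgD; [exact: cu | exact: cv].
- move=> phi cphi.
  rewrite (_ : _ \o _ = (EFin \o (fun t => du t * phi t))
      \+ (EFin \o (fun t => dv t * phi t))).
    by apply: integrableD => //; [exact: iu | exact: iv].
  by apply/funext => t /=; rewrite mulrDl EFinD.
- move=> phi tphi.
  have cphi := test_function_continuous tphi.
  have cdphi := test_function_derive1_continuous tphi.
  under eq_Rintegral do rewrite mulrDl.
  under [in RHS]eq_Rintegral do rewrite mulrDl.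
  rewrite !RintegralD//;
    [|exact: iu|exact: iv|exact: within_continuous_integrableM..].
  by rewrite wu// wv// opprD.
Qed.

Lemma weakly_diffZ c u du : weakly_diff u du ->
  weakly_diff (fun t => c * u t) (fun t => c * du t).
Proof.
move=> [cu iu wu]; split.
- by move=> x; apply: cvgM; [exact: cvg_cst | exact: cu].
- move=> phi cphi.
  rewrite (_ : _ \o _ = (fun t => c%:E * (EFin \o (fun t => (du t * phi t)%R)) t)%E).
    by apply: integrableZl => //; exact: iu.
  by apply/funext => t /=; rewrite -mulrA EFinM.
- move=> phi tphi.
  have cphi := test_function_continuous tphi.
  have cdphi := test_function_derive1_continuous tphi.
  under eq_Rintegral do rewrite -mulrA.
  under [in RHS]eq_Rintegral do rewrite -mulrA.
  rewrite !RintegralZl//; [|exact: iu|exact: within_continuous_integrableM].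
  by rewrite wu// mulrN.
Qed.

Lemma weakly_diff_sum (I : Type) (r : seq I) (u du : I -> R -> R) :
  (forall i, weakly_diff (u i) (du i)) ->
  weakly_diff (fun t => \sum_(i <- r) u i t) (fun t => \sum_(i <- r) du i t).
Proof.
move=> h; elim: r => [|i r IH].
  under eq_fun do rewrite big_nil.
  under [X in weakly_diff _ X]eq_fun do rewrite big_nil.
  exact: weakly_diff0.
under eq_fun do rewrite big_cons.
under [X in weakly_diff _ X]eq_fun do rewrite big_cons.
exact: weakly_diffD.
Qed.

Lemma weakly_diff_ae u du dv : weakly_diff u du ->
  {within `[a, b], continuous dv} ->
  {ae mu, forall t, `]a, b[%classic t -> du t = dv t} -> weakly_diff u dv.
Proof.
move=> [cu iu wu] cdv duv; split => //.
  by move=> phi cphi; exact: within_continuous_integrableM.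
move=> phi tphi; rewrite wu//; congr (- fine _).
have cphi := test_function_continuous tphi.
apply: ae_eq_integral => //.
- exact: (measurable_int mu (iu _ cphi)).
- exact: (measurable_int mu (within_continuous_integrableM cdv cphi)).
- by apply: ae_imply duv => t duv Dt; rewrite duv.
Qed.

(** If [f' + k f <= V] weakly and [f a <= V / k], then [f <= V / k]: the function
    [(V / k - f x) exp(k x)] has weak derivative [(V - f' - k f) exp(k x) >= 0]. *)
Lemma weak_gronwall (k V : R) f df : a < b -> 0 < k -> weakly_diff f df ->
  {ae mu, forall t, `]a, b[%classic t -> df t + k * f t <= V} ->
  f a <= V / k -> forall t, a <= t <= b -> f t <= V / k.
Proof.
move=> ab k0 [cf iF wf] hV fa t /andP[at_ tb].
pose E (x : R) : R := expR (k * x + 0).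
have sE : smooth E by move=> n; apply: diffn_affine; exact: diffn_expR.
have dE (x : R) : is_derive x 1 E (k * E x).
  by apply: is_derive_affine; exact: is_derive_expR.
pose u (x : R) := (V / k - f x) * E x.
have cu : {within `[a, b], continuous u}.
  move=> x; apply: cvgM.
    by apply: cvgB; [exact: cvg_cst | exact: cf].
  exact: (continuous_subspaceT (smooth_continuous sE)).
suff : u a <= u t.
  rewrite /u => h; rewrite -subr_ge0 -(pmulr_lge0 _ (expR_gt0 (k * t + 0))).
  by apply: le_trans h; rewrite mulr_ge0 ?expR_ge0// subr_ge0.
apply: (weak_nondecreasing ab cu) => // chi tchi chi0.
have schi := test_function_smooth tchi.
(* testing [u] against [chi] amounts to testing [f] against [exp(k x) chi] *)
pose phi (x : R) := E x * chi x.
have sphi : smooth phi by move=> n; exact: diffnM.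
have tphi : test_function a b phi.
  split; first by move=> n x; exact: smooth_derivable.
  apply: (subset_trans _ tchi.2); apply: closure_subset => x /=.
  by rewrite /phi mulf_eq0 negb_or => /andP[].
have cphi := test_function_continuous tphi.
have cdphi := test_function_derive1_continuous tphi.
have phi0 (x : R) : 0 <= phi x by rewrite mulr_ge0 ?expR_ge0.
have dphiE (x : R) : derive1 phi x = k * phi x + E x * derive1 chi x.
  have dchi : is_derive x 1 chi (derive1 chi x).
    exact: (diffn_is_derive x (schi 0%N)).
  have h : is_derive x 1 phi (k * E x * chi x + E x * derive1 chi x) :=
    is_derive_mul (dE x) dchi.
  by rewrite derive1E (derive_val (is_derive := h)) mulrA.
have iphi' : mu.-integrable `]a, b[ (EFin \o derive1 phi).
  by apply: continuous_oo_integrable; exact: continuous_subspaceT.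
have ifphi' := within_continuous_integrableM cf cdphi.
have iVphi : mu.-integrable `]a, b[ (EFin \o (fun x => (V - k * f x) * phi x)).
  apply: within_continuous_integrableM => // x; apply: cvgB; first exact: cvg_cst.
  by apply: cvgM; [exact: cvg_cst | exact: cf].
have icphi' : mu.-integrable `]a, b[ (EFin \o (fun x => V / k * derive1 phi x)).
  apply: within_continuous_integrableM => //.
  by apply: continuous_subspaceT => x; exact: cvg_cst.
have idf := iF _ cphi.
have -> : \int[mu]_(x in `]a, b[) (u x * derive1 chi x) =
  - \int[mu]_(x in `]a, b[) ((V - k * f x) * phi x - df x * phi x).
  rewrite RintegralB//.
  transitivity (\int[mu]_(x in `]a, b[)
     (V / k * derive1 phi x - f x * derive1 phi x - (V - k * f x) * phi x)).
    apply: eq_Rintegral => x _; rewrite dphiE /u /phi; field; exact: lt0r_neq0.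
  rewrite RintegralB//; last first.
    apply: continuous_oo_integrable => x; apply: cvgB.
      by apply: cvgM; [exact: cvg_cst | exact: (continuous_subspaceT cdphi)].
    by apply: cvgM; [exact: cf | exact: (continuous_subspaceT cdphi)].
  rewrite (RintegralB _ icphi' ifphi')// (RintegralZl (V / k) _ iphi')//.
  have dphi (x : R) : derivable phi x 1 by exact: (diffn_derivable (sphi 0%N)).
  rewrite (Rintegral_derive1 ab dphi cdphi).
  rewrite (@test_function_oo _ a tphi) ?ltxx//.
  rewrite (@test_function_oo _ b tphi) ?ltxx ?andbF//.
  by rewrite wf//; ring.
rewrite oppr_le0; apply: ae_Rintegral_ge0 => //.
  apply: measurable_funB; apply/measurable_EFinP.
    exact: (measurable_int mu iVphi).
  exact: (measurable_int mu idf).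
apply: ae_imply hV => x hV Dx; rewrite -mulrBl mulr_ge0//.
by have := hV Dx; lra.
Qed.

End weakly_differentiable.

(** * Tracking error of the relaxation equation *)

Section euclid.
Context {R : realType} {n : nat}.
Implicit Types v w : 'rV[R]_n.

Lemma enorm_ge0 v : 0 <= enorm v. Proof. exact: sqrtr_ge0. Qed.

Lemma sqr_enorm v : enorm v ^+ 2 = \sum_i v 0 i ^+ 2.
Proof. by rewrite sqr_sqrtr// sumr_ge0// => i _; exact: sqr_ge0. Qed.

Lemma enorm0 : enorm (0 : 'rV[R]_n) = 0.
Proof. by rewrite /enorm big1 ?sqrtr0// => i _; rewrite mxE expr0n. Qed.

Lemma enorm_cauchy_schwarz v w : \sum_i v 0 i * w 0 i <= enorm v * enorm w.
Proof.
set C := (X in X <= _); have CE : C = \sum_i v 0 i * w 0 i by [].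
have [v0|v0] := eqVneq (enorm v) 0.
  have h i : v 0 i = 0.
    have : \sum_i v 0 i ^+ 2 = 0 by rewrite -sqr_enorm v0 expr0n.
    move/eqP; rewrite psumr_eq0 => [/allP/(_ i)|j _]; last exact: sqr_ge0.
    by rewrite mem_index_enum sqrf_eq0 => /(_ isT)/eqP.
  by rewrite v0 mul0r CE big1// => i _; rewrite h mul0r.
clearbody C; have A0 : 0 < enorm v ^+ 2 by rewrite exprn_gt0// lt_def v0 enorm_ge0.
(* the squared norm of |v|^2 w - <v, w> v *)
have : 0 <= \sum_i (enorm v ^+ 2 * w 0 i - C * v 0 i) ^+ 2.
  by apply: sumr_ge0 => i _; exact: sqr_ge0.
have -> : \sum_i (enorm v ^+ 2 * w 0 i - C * v 0 i) ^+ 2 =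
    enorm v ^+ 2 * ((enorm v * enorm w) ^+ 2 - C ^+ 2).
  transitivity (enorm v ^+ 4 * (\sum_i w 0 i ^+ 2)
    - 2 * enorm v ^+ 2 * C * (\sum_i v 0 i * w 0 i) + C ^+ 2 * (\sum_i v 0 i ^+ 2)).
    rewrite !mulr_sumr -sumrB -big_split/=; apply: eq_bigr => i _; ring.
  rewrite -!sqr_enorm -CE; ring.
rewrite pmulr_rge0// subr_ge0 => h.
apply: le_trans (ler_norm _) _.
rewrite -[leRHS]ger0_norm ?mulr_ge0 ?enorm_ge0//.
by rewrite -ler_sqr ?nnegrE// !real_normK ?num_real.
Qed.

End euclid.

Section tracking.
Context {R : realType} {n : nat}.
Notation mu := (@lebesgue_measure R).

Lemma within_continuous_coord (a b : R) (u : R -> 'rV[R]_n) i :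
  {within `[a, b], continuous u} -> {within `[a, b], continuous (fun t => u t 0 i)}.
Proof.
move=> cu x; apply: (cvg_comp _ (fun v : 'rV[R]_n => v 0 i) (cu x)).
exact: coord_continuous.
Qed.

Lemma W1infty_weakly_diff P (a b : R) (u du : R -> 'rV[R]_n) i :
  W1infty P a b u du -> weakly_diff a b (fun t => u t 0 i) (fun t => du t 0 i).
Proof.
move=> [cu _ /(_ i)[_ Ldu wu]]; split => //.
  exact: within_continuous_coord.
by move=> phi; exact: Linfty_integrableM.
Qed.

Lemma ae_itv_nonempty (a b : R) (Q : R -> Prop) : a < b ->
  {ae mu, forall t, Q t} -> exists2 t, a <= t <= b & Q t.
Proof.
move=> ab hQ; apply: contrapT => nQ.
have : mu.-negligible `[a, b].
  apply: negligibleS hQ => t /=; rewrite in_itv/= => tab Qt.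
  by apply: nQ; exists t.
move=> /negligibleP => /(_ (measurable_itv _)).
rewrite /= lebesgue_measure_itv/= lte_fin ab -EFinD => -[] /eqP.
by rewrite subr_eq0 gt_eqF.
Qed.

(** A solution of [u' = k (us - u)] that starts on its target [us] stays within
    [V / k] of it when the target has speed at most [V]. For fixed [s], the scalar
    function [f t = <u s - us s, u t - us t>] satisfies
    [f' + k f = - <u s - us s, us'> <= |u s - us s| V], and [weak_gronwall] at
    [t = s] gives [|u s - us s| ^ 2 <= |u s - us s| V / k]. *)
Lemma relaxation_tracking P (a b k V : R) (us u dus du : R -> 'rV[R]_n) :
  a < b -> 0 < k -> W1infty P a b us dus -> W1infty P a b u du ->
  {ae mu, forall t, t \in `[a, b] -> du t = k *: (us t - u t)} ->
  {ae mu, forall t, t \in `[a, b] -> enorm (dus t) <= V} ->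
  u a = us a ->
  0 <= V /\ forall t, a <= t <= b -> enorm (u t - us t) <= V / k.
Proof.
move=> ab k0 hus hu ode hV uaE.
have V0 : 0 <= V.
  have [t tab Vt] := ae_itv_nonempty ab hV.
  by apply: le_trans (Vt _); [exact: enorm_ge0|rewrite in_itv].
split => // s sab.
set w := u s - us s.
have [w0|w0] := eqVneq (enorm w) 0.
  by rewrite w0 divr_ge0// ltW.
have wpos : 0 < enorm w by rewrite lt_def w0 enorm_ge0.
pose f t := \sum_i w 0 i * (u t 0 i + -1 * us t 0 i).
pose df t := \sum_i w 0 i * (k * (us t 0 i + -1 * u t 0 i) + -1 * dus t 0 i).
have wf : weakly_diff a b f df.
  apply: weakly_diff_sum => i; apply: weakly_diffZ; apply: weakly_diffD.
    apply: (weakly_diff_ae (W1infty_weakly_diff i hu)).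
      have cus : {within `[a, b], continuous (fun t => us t 0 i)}.
        by case: hus => cus _ _; exact: within_continuous_coord.
      have cu : {within `[a, b], continuous (fun t => u t 0 i)}.
        by case: hu => cu _ _; exact: within_continuous_coord.
      move=> x; apply: cvgM; first exact: cvg_cst.
      apply: cvgD; first exact: cus.
      by apply: cvgM; [exact: cvg_cst | exact: cu].
    apply: ae_imply ode => t ode tab.
    rewrite ode ?mxE; first by rewrite mulN1r.
    by move: tab; rewrite /= !in_itv/= => /andP[/ltW -> /ltW ->].
  exact: weakly_diffZ (W1infty_weakly_diff i hus).
have hdf : {ae mu, forall t, `]a, b[%classic t -> df t + k * f t <= enorm w * V}.
  apply: ae_imply hV => t Vt tab.
  have -> : df t + k * f t = \sum_i (- w) 0 i * dus t 0 i.
    rewrite /df /f mulr_sumr -big_split/=; apply: eq_bigr => i _.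
    rewrite !mxE; ring.
  apply: le_trans (enorm_cauchy_schwarz _ _) _.
  have -> : enorm (- w) = enorm w.
    by rewrite /enorm; congr Num.sqrt; apply: eq_bigr => i _; rewrite mxE sqrrN.
  rewrite ler_wpM2l ?enorm_ge0// Vt//.
  by move: tab; rewrite /= !in_itv/= => /andP[/ltW -> /ltW ->].
have fa : f a <= enorm w * V / k.
  rewrite /f big1 => [|i _]; last by rewrite uaE; ring.
  by rewrite divr_ge0 ?mulr_ge0 ?enorm_ge0// ltW.
have := weak_gronwall ab k0 wf hdf fa sab.
have -> : f s = enorm w ^+ 2.
  by rewrite sqr_enorm; apply: eq_bigr => i _; rewrite /w !mxE; ring.
by rewrite expr2 -mulrA ler_pM2l.
Qed.

End tracking.

(** * The delay estimate *)

Theorem corollary5p4 (R : realType)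
  (P : set 'rV[R]_10) (hP : admissible_parameters P)
  (LR : R) (hLR : 0 < LR)
  (hLip : forall theta1 theta2, P theta1 -> P theta2 ->
     `|R_LA theta1 - R_LA theta2| <= LR * enorm (theta1 - theta2))
  (t0 t1 : R) (ht : t0 < t1)
  (thetas theta dthetas dtheta : R -> 'rV[R]_10)
  (hthetas : W1infty P t0 t1 thetas dthetas)
  (htheta : W1infty P t0 t1 theta dtheta)
  (kappa : R) (hkappa : 0 < kappa)
  (hode : {ae @lebesgue_measure R, forall t, t \in `[t0, t1] ->
     dtheta t = kappa *: (thetas t - theta t)})
  (sigma : R) (hsigma : sigma = 1 \/ sigma = - 1)
  (tstar : R)
  (D1 : unique (fun s : R =>
     [/\ s \in `]t0, t1[,
         (forall t, t \in `[t0, s[ -> sigma * (R_LA (thetas t) - 1) < 0) &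
         R_LA (thetas s) = 1]) tstar)
  (mstar Deltastar : R) (hm : 0 < mstar) (hDelta : 0 < Deltastar)
  (hDelta1 : tstar + Deltastar <= t1)
  (D2 : forall t, t \in `[tstar, tstar + Deltastar] ->
     mstar * (t - tstar) <= sigma * (R_LA (thetas t) - 1))
  (D3 : forall t, t \in `[t0, t1] ->
     sigma * (R_LA (theta t) - 1) <= sigma * (R_LA (thetas t) - 1))
  (Vstar : R)
  (D4 : {ae @lebesgue_measure R, forall t, t \in `[t0, t1] ->
     enorm (dthetas t) <= Vstar})
  (Estar : R) (hE : Estar = enorm (theta t0 - thetas t0) + Vstar / kappa)
  (hLE : LR * Estar / mstar <= Deltastar)
  (teff : \bar R)
  (hteff : teff = ereal_inf [set t%:E | t in
     [set t | t \in `[t0, t1] /\ 0 <= sigma * (R_LA (theta t) - 1)]])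
  (hinit : theta t0 = thetas t0) :
  (0 <= teff - tstar%:E <= (LR / mstar * (Vstar / kappa))%:E)%E.
Proof.
have [V0 track] := relaxation_tracking ht hkappa hthetas htheta hode D4 hinit.
have [[+ before _] _] := D1; rewrite in_itv/= => /andP[t0s ts1].
(* by [D2], the delay after which [sigma (r_star - 1)] has reached the largest
   possible gap between [r_star] and [r_eff] *)
set h := LR / mstar * (Vstar / kappa).
have h0 : 0 <= h by apply: mulr_ge0; apply: divr_ge0 => //; exact: ltW.
have hD : h <= Deltastar.
  apply: le_trans hLE; rewrite hE hinit subrr enorm0 add0r /h.
  by rewrite mulrAC.
have sab : t0 <= tstar + h <= t1.
  by apply/andP; split; move: h0 hD hDelta1 t0s; clearbody h; lra.
have crossed : 0 <= sigma * (R_LA (theta (tstar + h)) - 1).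
  have star : mstar * h <= sigma * (R_LA (thetas (tstar + h)) - 1).
    have := D2 (tstar + h); rewrite (addrC tstar h) addrK; apply.
    by rewrite in_itv/= lerDr h0 addrC lerD2l.
  have gap : `|R_LA (theta (tstar + h)) - R_LA (thetas (tstar + h))| <= mstar * h.
    apply: le_trans (hLip _ _ _ _) _.
    - by have [_ + _] := htheta; apply; rewrite in_itv.
    - by have [_ + _] := hthetas; apply; rewrite in_itv.
    have -> : mstar * h = LR * (Vstar / kappa).
      by rewrite /h; field; rewrite !gt_eqF.
    by rewrite ler_pM2l// track.
  move: (R_LA (theta _)) (R_LA (thetas _)) gap star => r rs.
  move: (mstar * h) => mh /ler_normlP[].
  by clear -hsigma; case: hsigma => ->; lra.
have lb : (tstar%:E <= teff)%E.
  rewrite hteff; apply: le_ereal_inf_tmp => _ [t [tI ct] <-].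
  rewrite lee_fin leNgt; apply/negP => tlt.
  have := before t; rewrite in_itv/= tlt andbT.
  have := D3 _ tI; move: tI; rewrite in_itv/= => /andP[-> _] d3 /(_ isT).
  by rewrite ltNge (le_trans ct d3).
have ub : (teff <= (tstar + h)%:E)%E.
  rewrite hteff; apply: ereal_inf_lbound; exists (tstar + h) => //.
move: lb ub; rewrite -/h; clear hteff; case: teff => [r| |];
  rewrite ?leye_eq ?leeNy_eq// !lee_fin.
by move=> lb ub; rewrite subr_ge0 lb lerBlDl.
Qed.
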